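(* Let $\mathcal{U}$ be a properly weakly Ramsey (PWR) ultrafilter on $\mathbb{N}$, let $\mathcal{P}=\langle [p_n,p_{n+1})\mid n\in\mathbb{N}\rangle$ be an interval partition of $\mathbb{N}$ without selection set in $\mathcal{U}$, and let $A_p^{\mathcal{U}},B_p^{\mathcal{U}},C_p^{\mathcal{U}}$ be the cuts of the ultrapower $\mathbb{N}^{\mathbb{N}}/\mathcal{U}$ whose right parts are generated by $\mathcal{A}_p^{\mathcal{U}},\mathcal{B}_p^{\mathcal{U}},\mathcal{C}_p^{\mathcal{U}}$, respectively. Then: (1) $\mathcal{U}$ is PQS if and only if $\mathbb{N}\ne B_p^{\mathcal{U}}$, or equivalently if and only if $\mathcal{U}$ is not rapid. (2) $\mathcal{U}$ is SQS if and only if $A_p^{\mathcal{U}}<B_p^{\mathcal{U}}$, or equivalently $A_p^{\mathcal{U}}\ne C_p^{\mathcal{U}}$. (In particular, $\mathcal{U}$ is QS if and only if $\mathrm{id}<C_p^{\mathcal{U}}$.) (3) $\mathcal{U}$ is isomorphic to a QS ultrafilter if and only if $A_p^{\mathcal{U}}\ne B_p^{\mathcal{U}}$.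
   Context: All ultrafilters are nonprincipal ultrafilters on $\mathbb{N}$, and all functions are $\mathbb{N}\to\mathbb{N}$. $\mathcal{U}$ is weakly Ramsey (WR) if for every finite colouring of $[\mathbb{N}]^2$ there is $U\in\mathcal{U}$ such that $[U]^2$ has only (i.e. at most) two colours. $\mathcal{U}$ is selective if every function is constant or one-to-one on some set of $\mathcal{U}$; $\mathcal{U}$ is properly weakly Ramsey (PWR) if it is WR but not selective. $\mathcal{U}$ is rapid if for every increasing function $g$ there exists $U=\{u_1<u_2<\dots<u_n<\dots\}\in\mathcal{U}$ such that $u_n>g(n)$ for all $n$. Two ultrafilters $\mathcal{U},\mathcal{V}$ on $\mathbb{N}$ are isomorphic if $\mathcal{V}=\varphi\,\mathcal{U}=\{V\mid\varphi^{-1}[V]\in\mathcal{U}\}$ for some $\varphi$ that is one-to-one on a set of $\mathcal{U}$. A function is nondecreasing modulo $\mathcal{U}$ if its restriction to some $U\in\mathcal{U}$ is nondecreasing; it is unbounded modulo $\mathcal{U}$ if it is not bounded on any set of $\mathcal{U}$. For $f$ unbounded modulo $\mathcal{U}$, $\mathcal{U}$ is $f$-quasi-selective ($f$-QS) if every $g$ for which there is $U\in\mathcal{U}$ with $g(x)\le f(x)$ for all $x\in U$ is nondecreasing modulo $\mathcal{U}$. $\mathcal{U}$ is quasi-selective (QS) if it is $\mathrm{id}$-QS, $\mathrm{id}$ being the identity; properly quasi-selective (PQS) if it is $f$-QS for some, but not for all, functions $f$ unbounded modulo $\mathcal{U}$; strongly quasi-selective (SQS) if it is $f$-QS for some one-to-one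 function $f$. An interval partition is a partition of $\mathbb{N}$ into finite intervals $[p_n,p_{n+1})$, with $0=p_0<p_1<p_2<\cdots$. It has no selection set in $\mathcal{U}$ if there is no $U\in\mathcal{U}$ with $|U\cap[p_n,p_{n+1})|\le 1$ for all $n$. For $U\in\mathcal{U}$ and $p_n\le x<p_{n+1}$ put $$a_p^U(x)=|U\cap[p_n,x)|,\quad b_p^U(x)=|U\cap[x,p_{n+1})|,\quad c_p^U(x)=|U\cap[p_n,p_{n+1})|,$$ and let $\mathcal{A}_p^{\mathcal{U}}=\{a_p^U\mid U\in\mathcal{U}\}$, $\mathcal{B}_p^{\mathcal{U}}=\{b_p^U\mid U\in\mathcal{U}\}$, $\mathcal{C}_p^{\mathcal{U}}=\{c_p^U\mid U\in\mathcal{U}\}$. A cut of the linearly ordered ultrapower $\mathbb{N}^{\mathbb{N}}/\mathcal{U}$ is a partition of it into a downward closed left part and an upward closed right part. The cut whose right part is generated by a family of functions is the one whose right part is the upward closure of the set of $\mathcal{U}$-equivalence classes of the members of the family. Cuts are ordered by inclusion of their left parts. The cut $\mathbb{N}$ is the one whose left part consists of the classes of the constant functions. For a function $f$ and a cut $C$, $f<C$ means that the class of $f$ belongs to the left part of $C$. *)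

(* Defs.v *)
From HB Require Import structures.
From mathcomp Require Import all_boot all_order all_classical.
Set Implicit Arguments.
Unset Strict Implicit.
Unset Printing Implicit Defensive.
Import Order.TTheory.
Local Open Scope classical_set_scope.
Local Open Scope quotient_scope.
Local Open Scope nat_scope.

Record npultrafilter := NPUltrafilter {
  ufsets :> set nat -> Prop;
  ufsets_ultra : UltraFilter ufsets;
  ufsets_nonprincipal : forall n, ~ ufsets [set n] }.

Global Existing Instance ufsets_ultra.

(* [c x y], for x < y, is the colour of the pair {x, y}. *)
Definition weakly_Ramsey (U : npultrafilter) :=
  forall (k : nat) (c : nat -> nat -> 'I_k),
    exists2 S : set nat, U S &
      exists i j : 'I_k, forall x y, S x -> S y -> x < y ->
        c x y = i \/ c x y = j.

Definition selective (U : npultrafilter) :=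
  forall f : nat -> nat, exists2 S : set nat, U S &
    (exists m, forall x, S x -> f x = m) \/ {in S &, injective f}.

Definition properly_weakly_Ramsey (U : npultrafilter) :=
  weakly_Ramsey U /\ ~ selective U.

(* [u] enumerates the set from index 1 on; the value [u 0] plays no role
   beyond being smaller than [u 1]. *)
Definition rapid (U : npultrafilter) :=
  forall g : nat -> nat, {homo g : m n / m < n} ->
    exists u : nat -> nat,
      [/\ {in [pred n | 0 < n] &, {homo u : m n / m < n}},
          U (u @` [set n | 0 < n])
        & forall n, 0 < n -> g n < u n].

Definition isomorphic (U V : npultrafilter) :=
  exists phi : nat -> nat,
    (exists2 S : set nat, U S & {in S &, injective phi}) /\
    ufsets V = [set A | U (phi @^-1` A)].

Definition nondecreasing_mod (U : npultrafilter) (f : nat -> nat) :=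
  exists2 S : set nat, U S & {in S &, {homo f : x y / x <= y}}.

Definition unbounded_mod (U : npultrafilter) (f : nat -> nat) :=
  forall S : set nat, U S -> ~ exists m, forall x, S x -> f x <= m.

Definition f_quasi_selective (U : npultrafilter) (f : nat -> nat) :=
  unbounded_mod U f /\
  forall g : nat -> nat,
    (exists2 S : set nat, U S & forall x, S x -> g x <= f x) ->
    nondecreasing_mod U g.

Definition quasi_selective (U : npultrafilter) := f_quasi_selective U id.

Definition properly_quasi_selective (U : npultrafilter) :=
  (exists2 f, unbounded_mod U f & f_quasi_selective U f) /\
  ~ (forall f, unbounded_mod U f -> f_quasi_selective U f).

Definition strongly_quasi_selective (U : npultrafilter) :=
  exists2 f, injective f & f_quasi_selective U f.

Definition interval_partition (p : nat -> nat) :=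
  p 0 = 0 /\ {homo p : m n / m < n}.

(* |S ∩ [m, n)| *)
Definition card_itv (S : set nat) (m n : nat) : nat :=
  count (fun x => x \in S) (index_iota m n).

Definition has_selection_set (U : npultrafilter) (p : nat -> nat) :=
  exists2 S : set nat, U S & forall n, card_itv S (p n) (p n.+1) <= 1.

(* The n such that p n <= x < p n.+1, see [blockP]; the bound n <= x loses
   nothing since n <= p n. *)
Definition block (p : nat -> nat) (x : nat) : nat :=
  \max_(n < x.+1 | p n <= x) n.

Lemma blockP p x : interval_partition p ->
  p (block p x) <= x < p (block p x).+1.
Proof.
move=> [p0 pS].
have ge_id n : n <= p n by elim: n => // n IH; apply: leq_ltn_trans IH (pS _ _ _).
have px : p (block p x) <= x.
  rewrite /block; have P0 : p (@ord0 x) <= x by rewrite p0.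
  by rewrite (bigop.bigmax_eq_arg ord0) //; case: arg_maxnP.
rewrite px /= ltnNge; apply/negP => le_px.
have lt_x : (block p x).+1 < x.+1 by rewrite ltnS (leq_trans (ge_id _)).
have := @leq_bigmax_cond _ (fun n : 'I_x.+1 => p n <= x)
  (fun n => val n) (Ordinal lt_x) le_px.
by rewrite /= ltnn.
Qed.

Definition a_fun (p : nat -> nat) (S : set nat) (x : nat) : nat :=
  card_itv S (p (block p x)) x.
Definition b_fun (p : nat -> nat) (S : set nat) (x : nat) : nat :=
  card_itv S x (p (block p x).+1).
Definition c_fun (p : nat -> nat) (S : set nat) (x : nat) : nat :=
  card_itv S (p (block p x)) (p (block p x).+1).

Definition A_family (U : npultrafilter) p : set (nat -> nat) := [set a_fun p S | S in U].
Definition B_family (U : npultrafilter) p : set (nat -> nat) := [set b_fun p S | S in U].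
Definition C_family (U : npultrafilter) p : set (nat -> nat) := [set c_fun p S | S in U].

Section Ultrapower.
Variable U : npultrafilter.
Implicit Types f g h : nat -> nat.

Definition eq_mod f g : bool := `[< U [set x | f x = g x] >].
Definition le_mod f g : bool := `[< U [set x | f x <= g x] >].

Lemma eq_mod_refl : reflexive eq_mod.
Proof.
by move=> f; apply/asboolP; apply: (filterS _ (@filterT _ (ufsets U) _)).
Qed.

Lemma eq_mod_sym : symmetric eq_mod.
Proof.
by move=> f g; apply: asbool_equiv_eq; split; apply: filterS => x /= ->.
Qed.

Lemma eq_mod_trans : transitive eq_mod.
Proof.
move=> g f h /asboolP fg /asboolP gh; apply/asboolP.
by apply: filterS2 fg gh => x /= -> ->.
Qed.

Canonical eq_mod_equiv := EquivRel eq_mod eq_mod_refl eq_mod_sym eq_mod_trans.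

Definition ultrapower := {eq_quot eq_mod_equiv}.
HB.instance Definition _ := Choice.on ultrapower.
HB.instance Definition _ := EqQuotient.on ultrapower.

Definition ucls (f : nat -> nat) : ultrapower := \pi_ultrapower%qT f.

Lemma uclsP f g : reflect (U [set x | f x = g x]) (ucls f == ucls g).
Proof. by rewrite /ucls (eqmodE eq_mod_equiv f g); apply: asboolP. Qed.

Lemma ucls_repr (a : ultrapower) : ucls (repr a) = a.
Proof. exact: reprK. Qed.

Definition ule (a b : ultrapower) : bool := le_mod (repr a) (repr b).

Lemma ule_ucls f g : ule (ucls f) (ucls g) = le_mod f g.
Proof.
have /eqP/uclsP ff := ucls_repr (ucls f).
have /eqP/uclsP gg := ucls_repr (ucls g).
apply: asbool_equiv_eq; split => H.
  by apply: filterS (filterI H (filterI ff gg)) => x /= [le [<- <-]].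
by apply: filterS (filterI H (filterI ff gg)) => x /= [le [-> ->]].
Qed.

Lemma ule_refl : reflexive ule.
Proof.
by move=> a; apply/asboolP; apply: (filterS _ (@filterT _ (ufsets U) _)) => x /=.
Qed.

Lemma ule_anti : antisymmetric ule.
Proof.
move=> a b /andP[/asboolP ab /asboolP ba].
rewrite -[a]ucls_repr -[b]ucls_repr; apply/eqP/uclsP.
by apply: filterS2 ab ba => x /= le1 le2; apply/eqP; rewrite eqn_leq le1.
Qed.

Lemma ule_trans : transitive ule.
Proof.
move=> b a c /asboolP ab /asboolP bc; apply/asboolP.
by apply: filterS2 ab bc => x /=; apply: leq_trans.
Qed.

Lemma ule_total : total ule.
Proof.
move=> a b; apply/orP.
have [H|H] := in_ultra_setVsetC [set x | repr a x <= repr b x] (ufsets_ultra U).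
  by left; apply/asboolP.
by right; apply/asboolP; apply: filterS H => x /= /negP; rewrite -ltnNge => /ltnW.
Qed.

Fact ultrapower_display : Order.disp_t. Proof. exact: (Order.Disp tt tt). Qed.

HB.instance Definition _ :=
  Order.Le_isPOrder.Build ultrapower_display ultrapower ule_refl ule_anti ule_trans.
HB.instance Definition _ :=
  Order.POrder_isTotal.Build ultrapower_display ultrapower ule_total.

Lemma le_ucls f g : (ucls f <= ucls g)%O <-> U [set x | f x <= g x].
Proof.
have -> : (ucls f <= ucls g)%O = ule (ucls f) (ucls g) by [].
by rewrite ule_ucls; split => /asboolP.
Qed.

End Ultrapower.

Section Cuts.
Variables (d : Order.disp_t) (T : orderType d).

Record cut := Cut {
  cut_left : set T;
  cut_right : set T;
  cut_cover : cut_left `|` cut_right = setT;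
  cut_disjoint : cut_left `&` cut_right = set0;
  cut_left_down : forall x y, (x <= y)%O -> cut_left y -> cut_left x;
  cut_right_up : forall x y, (x <= y)%O -> cut_right x -> cut_right y }.

Definition cut_lt (C D : cut) := cut_left C `<` cut_left D.

Lemma cut_eq (C D : cut) : cut_left C = cut_left D -> C = D.
Proof.
case: C D => [L R c1 d1 l1 r1] [L' R' c2 d2 l2 r2] /= E; subst L'.
have RC M : L `|` M = setT -> L `&` M = set0 -> M = ~` L.
  move=> cM dM; apply/seteqP; split=> x /= xM.
    by move=> xL; have : (L `&` M) x by []; rewrite dM.
  by have : (L `|` M) x by [rewrite cM]; case.
have E : R = R' by rewrite (RC _ c1 d1) (RC _ c2 d2).
by subst R'; congr Cut; apply: Prop_irrelevance.
Qed.

Definition up_closure (F : set T) : set T := [set x | exists2 y, F y & (y <= x)%O].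

Lemma up_closure_up F x y : (x <= y)%O -> up_closure F x -> up_closure F y.
Proof. by move=> xy [z Fz zx]; exists z => //; apply: le_trans xy. Qed.

Lemma up_closureC_down F x y :
  (x <= y)%O -> (~` up_closure F) y -> (~` up_closure F) x.
Proof. by move=> xy Fy /(up_closure_up xy). Qed.

Definition right_generated_cut (F : set T) : cut :=
  Cut (setvU (up_closure F)) (setICl (up_closure F))
    (@up_closureC_down F) (@up_closure_up F).

Definition left_cut (L : set T)
    (Ld : forall x y, (x <= y)%O -> L y -> L x) : cut :=
  Cut (setUv L) (setICr L) Ld
    (fun x y xy (Lx : (~` L) x) Ly => Lx (Ld x y xy Ly)).

End Cuts.

Section UltrapowerCuts.
Variable U : npultrafilter.

Definition constant_classes : set (ultrapower U) :=
  range (fun m : nat => ucls U (fun _ => m)).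

Lemma constant_classes_down (a b : ultrapower U) :
  (a <= b)%O -> constant_classes b -> constant_classes a.
Proof.
move=> ab [m _ bm]; move: ab; rewrite -bm -[a]ucls_repr le_ucls => {bm}.
elim: m => [|m IH] H.
  exists 0 => //; apply/eqP/uclsP; apply: filterS H => x /=.
  by rewrite leqn0 => /eqP.
have [E|E] := in_ultra_setVsetC [set x | repr a x = m.+1] (ufsets_ultra U).
  by exists m.+1 => //; apply/eqP/uclsP; apply: filterS E => x /= ->.
apply: IH; apply: filterS2 H E => x /= H /eqP E.
by rewrite -ltnS ltn_neqAle E.
Qed.

Definition cutN : cut (ultrapower U) := left_cut constant_classes_down.

Definition cutA (p : nat -> nat) : cut (ultrapower U) :=
  right_generated_cut (ucls U @` A_family U p).
Definition cutB (p : nat -> nat) : cut (ultrapower U) :=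
  right_generated_cut (ucls U @` B_family U p).
Definition cutC (p : nat -> nat) : cut (ultrapower U) :=
  right_generated_cut (ucls U @` C_family U p).

Definition fun_lt_cut (f : nat -> nat) (C : cut (ultrapower U)) :=
  cut_left C (ucls U f).

End UltrapowerCuts.

(* Main.v *)
Require Import Defs.
From mathcomp Require Import all_boot all_order all_classical.
From mathcomp Require Import zify.
Set Implicit Arguments.
Unset Strict Implicit.
Unset Printing Implicit Defensive.
Local Open Scope classical_set_scope.
Local Open Scope nat_scope.

(** Since no set of [U] meets every interval of [p] in at most one point, and
every set of [U] meets infinitely many intervals, each set of [U] contains
both pairs lying in one interval and pairs lying in two. Refining a colouring
by this distinction already uses up the two colours that weak Ramseyness
leaves; hence every finite colouring of pairs depends, on some set of [U],
only on whether the pair lies in one interval ([homogeneous]).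

Colouring pairs by the comparison of the values of [f] gives a normal form
([unbounded_trichotomy]): on a set of [U], an unbounded [f] increases from each
interval to the next and is, inside intervals, either increasing, or constant,
or decreasing. Apart from the first interval, [a_fun p S] and [b_fun p S] are,
on [S], the least functions of the first and of the third kind, so that such an
[f] lies above the cut [A], respectively above the cut [B]. Everything is read
off from this in terms of [A], [B] and [C].

- [f] fails to bound only nondecreasing functions exactly when it bounds one
  of the third kind: [U] is [f]-quasi-selective iff [f < B]
  ([f_quasi_selectiveP]). As some functions are above [B] (and all of these are
  unbounded), [U] is PQS iff some unbounded [f] is below [B].
- If [U] is rapid, a set of [U] can be chosen so thin that it has at most
  [f x] points before the end of the interval of [x], so all unbounded [f] are
  above [B] ([aboveB_of_rapid]). Conversely, if all of them are, some set of
  [U] has very few points in each interval, and by [homogeneous] its successive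
  nonempty intervals can also be taken far apart ([rapid_of_aboveB]).
- An injective [f < B] is increasing on a set of [U], hence above [A];
  conversely a function [a_fun p S] is injective on a set of [U]. So [U] is SQS
  iff [A < B]. A nondecreasing function above [B] is even above [C], since the
  value of [b_fun p S] at the first point of an interval is that of
  [c_fun p S]; so [B] may be replaced by [C] here, and for the identity.
- The image of [U] by [phi] is quasi-selective iff every function bounded by
  [phi] is monotone for the order that [phi] pulls back
  ([quasi_selective_imageP]). If [A = B], an injective [phi] is above both
  cuts, so it bounds some [a_fun p S] and some [b_fun p T], which vary in
  opposite directions inside intervals. If [A] and [B] differ, some [a_fun p S]
  is below [B] or some [b_fun p S] is below [A], and it serves as [phi]. *)

(** * Counting points of a set in an interval *)

(** The pigeonhole principle. The offset [L] serves [b_fun_le], where the value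
[0] is not taken. *)
Lemma card_itv_le_inj (S : set nat) (g : nat -> nat) m n L N :
  (forall x, S x -> m <= x < n -> L <= g x < L + N) ->
  (forall x y, S x -> S y -> m <= x -> x < y -> y < n -> g x <> g y) ->
  card_itv S m n <= N.
Proof.
move=> gLN ginj; rewrite /card_itv -size_filter -(size_map g) -[N in _ <= N](size_iota L).
set s := [seq x <- _ | _].
have sP x : x \in s -> S x /\ m <= x < n.
  by rewrite mem_filter mem_index_iota => /andP[/set_mem].
apply: uniq_leq_size.
  rewrite map_inj_in_uniq; first by rewrite filter_uniq ?iota_uniq.
  move=> x y /sP[Sx /andP[mx xn]] /sP[Sy /andP[my yn]] gE.
  by case: (ltngtP x y) => // xy; [case: (ginj x y)|case: (ginj y x)].
by move=> _ /mapP[x /sP[Sx xmn] ->]; rewrite mem_iota gLN.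
Qed.

Lemma card_itv_cat S m k n : m <= k -> k <= n ->
  card_itv S m n = card_itv S m k + card_itv S k n.
Proof.
move=> mk kn; rewrite /card_itv /index_iota.
rewrite (_ : n - m = (k - m) + (n - k)); last by lia.
by rewrite iotaD count_cat subnKC.
Qed.

Lemma card_itv_sub (S T : set nat) m n : S `<=` T -> card_itv S m n <= card_itv T m n.
Proof. by move=> ST; apply: sub_count => x /set_mem /ST /mem_set. Qed.

Lemma card_itv_gt0 (S : set nat) m n x : S x -> m <= x -> x < n -> 0 < card_itv S m n.
Proof.
move=> Sx mx xn; rewrite /card_itv -has_count; apply/hasP.
by exists x; [rewrite mem_index_iota mx|apply/mem_set].
Qed.

Lemma card_itv_pair (S : set nat) m n : 1 < card_itv S m n ->
  exists x y, [/\ S x, S y, m <= x, x < y & y < n].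
Proof.
move=> S2; apply/not_existsP => noxy; move: S2; apply/negP; rewrite -leqNgt.
apply: (@card_itv_le_inj S (fun=> 0) m n 0) => // x y Sx Sy mx xy yn _.
by apply: (noxy x); exists y.
Qed.

Lemma card_itv_first (S : set nat) m n x : S x -> m <= x -> x < n ->
  exists q, [/\ S q, m <= q <= x & card_itv S q n = card_itv S m n].
Proof.
move=> Sx mx xn.
have ex : exists q, (q \in S) && (m <= q) by exists x; rewrite mem_set.
case: (ex_minnP ex) => q /andP[/set_mem Sq mq] qmin.
have qx : q <= x by apply: qmin; rewrite mem_set.
exists q; rewrite mq qx; split=> //.
rewrite (@card_itv_cat S m q n) //; last by rewrite ltnW // (leq_ltn_trans qx).
suff /eqP -> : card_itv S m q == 0 by [].
rewrite -leqn0; apply: (@card_itv_le_inj S id m q 0 0) => [y Sy /andP[my]|].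
  by rewrite ltnNge qmin // mem_set.
by move=> y z _ _ _ /=; lia.
Qed.

(** The enumeration is the inverse, on [T], of the function [r] counting the
points of [T] below: [r] grows by one from a point of [T] to the next. *)
Lemma enum_infinite (T : set nat) : (forall n, exists2 x, T x & n <= x) ->
  exists u : nat -> nat, [/\ {homo u : m n / m < n}, range u = T &
    forall n, card_itv T 0 (u n) = n].
Proof.
move=> Tinf; pose r x := card_itv T 0 x.
have r_le x y : x <= y -> r x <= r y.
  by move=> xy; rewrite /r (@card_itv_cat T 0 x y) // leq_addr.
have r_lt x y : T x -> x < y -> r x < r y.
  move=> Tx xy; rewrite /r (@card_itv_cat T 0 x y) //; last exact: ltnW.
  by rewrite -[X in X < _]addn0 ltn_add2l (@card_itv_gt0 T x y x).
have next k : exists q, [/\ T q, k <= q & r q = r k].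
  have [x Tx kx] := Tinf k.
  have [q [Tq /andP[kq qx] E]] := @card_itv_first T k x.+1 x Tx kx (ltnSn x).
  exists q; split=> //.
  move: E; rewrite (@card_itv_cat T k q x.+1) // => [|]; last by rewrite ltnW // ltnS.
  by rewrite /r (@card_itv_cat T 0 k q) // => ?; lia.
have ex n : exists x, T x /\ r x = n.
  elim: n => [|n [x [Tx rx]]].
    by have [q [Tq _ rq]] := next 0; exists q.
  have [q [Tq _ rq]] := next x.+1; exists q; split=> //.
  rewrite rq /r (@card_itv_cat T 0 x x.+1) // -/(r x) rx.
  have := @card_itv_gt0 T x x.+1 x Tx (leqnn _) (ltnSn _).
  have : card_itv T x x.+1 <= 1.
    by rewrite /card_itv (leq_trans (count_size _ _)) // size_iota; lia.
  lia.
have [u uP] := choice ex; exists u; split.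
- move=> m n mn; rewrite ltnNge; apply/negP => /r_le.
  by rewrite (uP n).2 (uP m).2 leqNgt mn.
- apply/seteqP; split=> [_ [n _ <-]|x Tx]; first exact: (uP n).1.
  exists (r x) => //; have [Tu ru] := uP (r x).
  by case: (ltngtP (u (r x)) x) => // /r_lt; [move=> /(_ Tu)|move=> /(_ Tx)]; rewrite ru ltnn.
- by move=> n; exact: (uP n).2.
Qed.

(** * Functions modulo an ultrafilter and cuts of the ultrapower *)

Section Ultra.
Variable U : npultrafilter.
Implicit Types (S T : set nat) (f g h : nat -> nat).

Lemma uf_setI S T : U S -> U T -> U (S `&` T).
Proof. exact: filterI. Qed.

Lemma uf_nonempty S : U S -> exists x, S x.
Proof. by move=> US; apply: (@filter_ex _ (ufsets U)). Qed.

Lemma uf_tail n : U [set x | n <= x].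
Proof.
elim: n => [|n IH]; first by apply: filterS (@filterT _ (ufsets U) _) => x.
case: (in_ultra_setVsetC [set n] (ufsets_ultra U)) => [/ufsets_nonprincipal //|Un].
by apply: filterS (uf_setI IH Un) => x /= [nx /eqP xn]; rewrite ltn_neqAle eq_sym xn.
Qed.

Lemma uf_infinite S : U S -> forall n, exists2 x, S x & n <= x.
Proof. by move=> US n; have [x [Sx nx]] := uf_nonempty (uf_setI US (uf_tail n)); exists x. Qed.

Lemma const_of_bounded f : ~ unbounded_mod U f -> exists m, U [set x | f x = m].
Proof.
move=> nub.
have [S US [m fm]] : exists2 S : set nat, U S & exists m, forall x, S x -> f x <= m.
  by apply: contrapT => no; apply: nub => S US [m fm]; apply: no; exists S => //; exists m.
have [||k _ /eqP/uclsP E] := @constant_classes_down U (ucls U f) (ucls U (fun=> m)).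
- by apply/le_ucls; apply: filterS US.
- by exists m.
by exists k; apply: filterS E => x /= ->.
Qed.

Lemma unbounded_of_inj f S : U S -> {in S &, injective f} -> unbounded_mod U f.
Proof.
move=> US finj; apply: contrapT => /const_of_bounded[m Um].
have USm := uf_setI US Um.
have [x [Sx fx]] := uf_nonempty USm.
have [y [Sy fy] xy] := uf_infinite USm x.+1.
by have := finj x y (mem_set Sx) (mem_set Sy); rewrite fx fy => /(_ erefl) E; rewrite E ltnn in xy.
Qed.

Lemma unbounded_le f g : U [set x | f x <= g x] -> unbounded_mod U f -> unbounded_mod U g.
Proof.
move=> fg fub S US [m gm]; apply: (fub _ (uf_setI US fg)); exists m => x [Sx fgx].
exact: leq_trans fgx (gm x Sx).
Qed.

Lemma unbounded_id : unbounded_mod U id.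
Proof. by apply: (@unbounded_of_inj id setT) => //; apply: filterT. Qed.

(** Some set [T] of [U] carries values of [f] of a single parity, which leaves
the values of the other parity for an injection of the complement of [T]. *)
Lemma extend_injective f S : U S -> {in S &, injective f} ->
  exists2 f', injective f' & U [set x | f x = f' x].
Proof.
move=> US finj.
have [b Ub] : exists b, U [set x | odd (f x) = b].
  have [E|E] := in_ultra_setVsetC [set x | odd (f x)] (ufsets_ultra U).
    by exists true; apply: filterS E => x.
  by exists false; apply: filterS E => x /= /negP/negbTE.
pose T := S `&` [set x | odd (f x) = b].
have UT : U T by apply: uf_setI.
exists (fun x => if x \in T then f x else (~~ b) + x.*2); last first.
  by apply: filterS UT => x Tx /=; rewrite mem_set.
have oddN x : odd ((~~ b) + x.*2) = ~~ b by rewrite oddD odd_double addbF; case: b {Ub T UT}.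
move=> x y; case: (boolP (x \in T)) (boolP (y \in T)) => [/set_mem[Sx fx]|Tx] [/set_mem[Sy fy]|Ty].
- by move=> /finj; apply; apply/mem_set.
- by move=> /(congr1 odd); rewrite oddN fx; case: (b).
- by move=> /(congr1 odd); rewrite oddN fy; case: (b).
- by move=> /addnI /double_inj.
Qed.

(** [f] belongs to the right part of the cut that [F] generates; see
[cut_left_above]. *)
Definition above (F : set (nat -> nat)) (f : nat -> nat) :=
  exists2 g, F g & U [set x | g x <= f x].

Lemma above_le F f g : above F f -> U [set x | f x <= g x] -> above F g.
Proof.
by move=> [h Fh hf] fg; exists h => //; apply: filterS2 hf fg => x /=; apply: leq_trans.
Qed.

Lemma cut_left_above F f :
  cut_left (right_generated_cut (ucls U @` F)) (ucls U f) <-> ~ above F f.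
Proof.
split=> /= nF; [move=> [g Fg gf]|move=> [_ [g Fg <-] /le_ucls gf]].
  by apply: nF; exists (ucls U g); [exists g|apply/le_ucls].
by apply: nF; exists g.
Qed.

Lemma cut_left_N f : cut_left (cutN U) (ucls U f) <-> ~ unbounded_mod U f.
Proof.
split=> /=.
  move=> [m _ /eqP/uclsP mf] /(_ _ mf); apply; exists m => x /= <- //.
by move=> /const_of_bounded[m Um]; exists m => //; apply/eqP/uclsP; apply: filterS Um => x /= ->.
Qed.

Lemma cut_subP (C D : cut (ultrapower U)) :
  (forall f, cut_left C (ucls U f) -> cut_left D (ucls U f)) -> cut_left C `<=` cut_left D.
Proof. by move=> CD a; rewrite -[a]ucls_repr; apply: CD. Qed.

Lemma cut_neqP (C D : cut (ultrapower U)) :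
  (forall f, cut_left C (ucls U f) -> cut_left D (ucls U f)) ->
  C <> D <-> exists2 f, ~ cut_left C (ucls U f) & cut_left D (ucls U f).
Proof.
move=> CD; split=> [neq|[f nC D_f] E]; last by rewrite E in nC.
apply: contrapT => no; apply: neq; apply: cut_eq; apply/seteqP; split; apply: cut_subP => // f Df.
by apply: contrapT => nC; apply: no; exists f.
Qed.

(** Cuts are linearly ordered, so one element separating them decides their
order. *)
Lemma cut_ltP (C D : cut (ultrapower U)) :
  cut_lt C D <-> exists2 f, ~ cut_left C (ucls U f) & cut_left D (ucls U f).
Proof.
split=> [[CD DC]|[f nC Df]].
  apply: contrapT => no; apply: DC; apply: cut_subP => f Df.
  by apply: contrapT => nC; apply: no; exists f.
split=> [|DC]; last by apply: nC; apply: DC.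
apply: cut_subP => g Cg.
have [fg|gf] := boolP (ucls U f <= ucls U g)%O.
  by case: nC; apply: cut_left_down fg Cg.
by apply: cut_left_down Df; apply: Order.POrderTheory.ltW; rewrite Order.TotalTheory.ltNge.
Qed.

End Ultra.

(** * Images of an ultrafilter *)

Section Image.
Variables (U : npultrafilter) (phi : nat -> nat).

Lemma image_ultrafilter : unbounded_mod U phi ->
  exists V : npultrafilter, ufsets V = [set A | U (phi @^-1` A)].
Proof.
move=> ub; pose F : set (set nat) := [set A | U (phi @^-1` A)].
have FF : ProperFilter F.
  split; first by rewrite /F /= preimage_set0; apply: filter_not_empty.
  split; rewrite /F /=.
  - by rewrite preimage_setT; apply: filterT.
  - by move=> A B; apply: uf_setI.
  - by move=> A B AB; apply: filterS => x; apply: AB.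
have UF : UltraFilter F.
  split=> // G PG FG; apply/seteqP; split=> // A GA; rewrite /F /=.
  have [//|UnA] := in_ultra_setVsetC (phi @^-1` A) (ufsets_ultra U).
  have GnA : G (~` A) by apply: FG.
  have : G (A `&` ~` A) by apply: filterI.
  by rewrite setICr => /(@filter_not_empty _ _ PG).
have nF n : ~ F [set n].
  by move=> Un; apply: (ub _ Un); exists n => x /= ->.
by exists (NPUltrafilter UF nF).
Qed.

(** Functions modulo the image of [U] are functions modulo [U], composed with
[phi] in one direction and with an inverse [psi] of [phi] on [S] in the other;
the order of the image then becomes the comparison of the values of [phi]. *)
Lemma quasi_selective_imageP (V : npultrafilter) (S : set nat) :
  ufsets V = [set A | U (phi @^-1` A)] -> U S -> {in S &, injective phi} ->
  quasi_selective V <-> forall h : nat -> nat, U [set x | h x <= phi x] ->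
    exists2 T : set nat, U T & forall x y, T x -> T y -> phi x <= phi y -> h x <= h y.
Proof.
move=> VU US phinj; split=> [[_ QS] h hphi|H].
  pose psi y := xget 0 [set x | S x /\ phi x = y].
  have psiK x : S x -> psi (phi x) = x.
    move=> Sx; have [|Spsi phipsi] := @xgetPex _ 0 [set z | S z /\ phi z = phi x].
      by exists x.
    by apply: phinj; rewrite ?mem_set.
  have [W VW hW] : nondecreasing_mod V (h \o psi).
    apply: QS; exists [set y | h (psi y) <= y] => //.
    rewrite VU /=; apply: filterS2 US hphi => x Sx /=; by rewrite psiK.
  rewrite VU /= in VW; exists (S `&` (phi @^-1` W)); first exact: uf_setI.
  move=> x y [Sx Wx] [Sy Wy] xy.
  by have := hW (phi x) (phi y) (mem_set Wx) (mem_set Wy) xy; rewrite /= !psiK.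
split; first exact: unbounded_id.
move=> g [W VW gW]; have UW : U (phi @^-1` W) by move: VW; rewrite VU.
have [|T UT hT] := H (g \o phi); first by apply: filterS UW => x; apply: gW.
exists (phi @` T); first by rewrite VU /=; apply: filterS UT => x Tx; exists x.
by move=> _ _ /set_mem[x Tx <-] /set_mem[y Ty <-]; apply: hT.
Qed.

End Image.

(** * The normal form of a function modulo a weakly Ramsey ultrafilter *)

Section Partition.
Variable p : nat -> nat.
Hypothesis hp : interval_partition p.
Local Notation bl := (block p).
Implicit Types (S T : set nat) (f g h : nat -> nat).

Lemma interval_partition_mono m n : m <= n -> p m <= p n.
Proof.
by rewrite leq_eqVlt => /predU1P[->//|/(hp.2)/ltnW].
Qed.

Lemma block_uniq n x : p n <= x < p n.+1 -> bl x = n.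
Proof.
move=> /andP[nx xn]; have /andP[bx xb] := blockP x hp.
case: (ltngtP (bl x) n) => // lt.
  by have := interval_partition_mono lt; lia.
by have := interval_partition_mono lt; lia.
Qed.

Lemma le_block m x : p m <= x -> m <= bl x.
Proof.
move=> mx; have /andP[_ xb] := blockP x hp.
by rewrite leqNgt; apply/negP => /interval_partition_mono; lia.
Qed.

Lemma block_mono x y : x <= y -> bl x <= bl y.
Proof.
by move=> xy; have /andP[bx _] := blockP x hp; apply: le_block; apply: leq_trans xy.
Qed.

Lemma block_lt x y : bl x < bl y -> x < y.
Proof. by move=> lt; rewrite ltnNge; apply/negP => /block_mono; rewrite leqNgt lt. Qed.

Lemma le_interval_partition n : n <= p n.
Proof. by elim: n => // n IH; apply: leq_ltn_trans IH (hp.2 _ _ (ltnSn n)). Qed.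

Lemma a_fun_lt S x y : S x -> x < y -> bl x = bl y -> a_fun p S x < a_fun p S y.
Proof.
move=> Sx xy E; rewrite /a_fun -E; have /andP[bx _] := blockP x hp.
rewrite (@card_itv_cat S _ x y) //; last exact: ltnW.
by rewrite -[X in X < _]addn0 ltn_add2l (@card_itv_gt0 S x y x).
Qed.

Lemma b_fun_lt S x y : S x -> x < y -> bl x = bl y -> b_fun p S y < b_fun p S x.
Proof.
move=> Sx xy E; rewrite /b_fun -E; have /andP[_] := blockP y hp; rewrite -E => yb.
rewrite (@card_itv_cat S x y) //; [|exact: ltnW|exact: ltnW].
by rewrite -[X in X < _]add0n ltn_add2r (@card_itv_gt0 S x y x).
Qed.

Lemma abc_fun S x : c_fun p S x = a_fun p S x + b_fun p S x.
Proof.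
by have /andP[bx /ltnW xb] := blockP x hp; rewrite /c_fun (@card_itv_cat S _ x).
Qed.

(** Through the first point [q] of [S] in an interval, a bound on [b_fun p S] at
single points bounds the number of points in the whole interval. *)
Lemma c_fun_first S x : S x ->
  exists q, [/\ S q, q <= x, bl q = bl x & b_fun p S q = c_fun p S x].
Proof.
move=> Sx; have /andP[bx xb] := blockP x hp.
have [q [Sq /andP[bq qx] E]] := card_itv_first Sx bx xb.
have qE : bl q = bl x by apply: block_uniq; rewrite bq (leq_ltn_trans qx).
by exists q; split; rewrite // /b_fun qE.
Qed.

Definition incr_across f S := forall x y, S x -> S y -> bl x < bl y -> f x < f y.
Definition mono_within (r : rel nat) f S :=
  forall x y, S x -> S y -> x < y -> bl x = bl y -> r (f x) (f y).

Lemma incr_across_sub f S T : T `<=` S -> incr_across f S -> incr_across f T.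
Proof. by move=> TS fS x y /TS Sx /TS Sy; apply: fS. Qed.

Lemma mono_within_sub r f S T : T `<=` S -> mono_within r f S -> mono_within r f T.
Proof. by move=> TS fS x y /TS Sx /TS Sy; apply: fS. Qed.

Lemma a_fun_within S : mono_within ltn (a_fun p S) S.
Proof. by move=> x y Sx _; apply: a_fun_lt. Qed.

Lemma b_fun_within S : mono_within gtn (b_fun p S) S.
Proof. by move=> x y Sx _; apply: b_fun_lt. Qed.

Lemma across_inj f S : incr_across f S -> mono_within ltn f S \/ mono_within gtn f S ->
  {in S &, injective f}.
Proof.
move=> fa fw.
have H x y : S x -> S y -> x < y -> f x <> f y.
  move=> Sx Sy xy; have := block_mono (ltnW xy); rewrite leq_eqVlt => /orP[/eqP E|lt].
    by case: fw => fw; have := fw x y Sx Sy xy E => /= + E'; rewrite E' ltnn.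
  by have := fa x y Sx Sy lt => + E; rewrite E ltnn.
move=> x y /set_mem Sx /set_mem Sy E.
by case: (ltngtP x y) => // xy; [case: (H x y)|case: (H y x)].
Qed.

Lemma across_homo f S : incr_across f S -> mono_within leq f S ->
  {in S &, {homo f : x y / x <= y}}.
Proof.
move=> fa fw x y /set_mem Sx /set_mem Sy; rewrite leq_eqVlt => /predU1P[->//|xy].
have := block_mono (ltnW xy); rewrite leq_eqVlt => /orP[/eqP E|lt]; first exact: fw.
by apply/ltnW/fa.
Qed.

(** [f] maps the points of [S] that [a_fun p S x] counts injectively
below [f x]. *)
Lemma a_fun_le f S x : mono_within ltn f S -> S x -> a_fun p S x <= f x.
Proof.
move=> fw Sx; have /andP[bx xb] := blockP x hp.
have E y : p (bl x) <= y < x -> bl y = bl x.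
  by move=> /andP[xy yx]; apply: block_uniq; rewrite xy; lia.
apply: (@card_itv_le_inj S f _ _ 0) => [y Sy xyx|y z Sy Sz xy yz zx].
  by rewrite add0n /=; apply: fw => //; [case/andP: xyx|exact: E].
by have /= := fw y z Sy Sz yz; rewrite !E; [lia|lia|lia].
Qed.

(** The points counted by [b_fun p S x] include [x] itself, so [f] maps them
injectively to [1, ..., f x]; positivity saves the missing unit. *)
Lemma b_fun_le f S x : mono_within gtn f S -> (forall y, S y -> 0 < f y) -> S x ->
  b_fun p S x <= f x.
Proof.
move=> fw f0 Sx; have /andP[bx xb] := blockP x hp.
have E y : x <= y < p (bl x).+1 -> bl y = bl x.
  by move=> /andP[xy yx]; apply: block_uniq; rewrite yx andbT; lia.
apply: (@card_itv_le_inj S f _ _ 1) => [y Sy xyx|y z Sy Sz xy yz zx].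
  rewrite f0 //= add1n ltnS; move: xyx => /andP[]; rewrite leq_eqVlt.
  by move=> /predU1P[->//|xy] yx; apply: ltnW; apply: fw => //; rewrite E // (ltnW xy).
by have /= := fw y z Sy Sz yz; rewrite !E; [lia|lia|lia].
Qed.

Variable U : npultrafilter.
Hypothesis hWR : weakly_Ramsey U.
Hypothesis hsel : ~ has_selection_set U p.

Lemma same_block_pair S : U S -> exists x y, [/\ S x, S y, x < y & bl x = bl y].
Proof.
move=> US; apply: contrapT => no; apply: hsel; exists S => // n.
rewrite leqNgt; apply/negP => /card_itv_pair[x [y [Sx Sy nx xy yn]]].
apply: no; exists x, y; split=> //.
by rewrite (@block_uniq n x) ?(@block_uniq n y) //; lia.
Qed.

Lemma diff_block_pair S : U S -> exists x y, [/\ S x, S y & bl x < bl y].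
Proof.
move=> US; have [x Sx _] := uf_infinite US 0.
have [y Sy xy] := uf_infinite US (p (bl x).+1).
by exists x, y; split=> //; apply: le_block.
Qed.

(** The pairs are coloured by [c] together with whether they lie in one
interval. Both values of the second component occur on every set of [U], so
each of the two remaining colours carries one of them. *)
Lemma homogeneous (C : finType) (c : nat -> nat -> C) :
  exists2 S : set nat, U S & exists i j : C,
    forall x y, S x -> S y -> x < y -> c x y = if bl x == bl y then i else j.
Proof.
have [S US [i [j Sij]]] := hWR (fun x y => enum_rank (c x y, bl x == bl y)).
have {}Sij x y : S x -> S y -> x < y ->
    (c x y, bl x == bl y) = enum_val i \/ (c x y, bl x == bl y) = enum_val j.
  by move=> Sx Sy xy; case: (Sij x y Sx Sy xy) => <-; rewrite enum_rankK; [left|right].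
exists S => //.
have [x1 [y1 [Sx1 Sy1 xy1 /eqP E1]]] := same_block_pair US.
have [x2 [y2 [Sx2 Sy2 lt2]]] := diff_block_pair US.
have E2 : (bl x2 == bl y2) = false by rewrite ltn_eqF.
have H1 := Sij _ _ Sx1 Sy1 xy1; have H2 := Sij _ _ Sx2 Sy2 (block_lt lt2).
rewrite E1 in H1; rewrite E2 in H2.
exists (c x1 y1), (c x2 y2) => x y Sx Sy xy; have := Sij x y Sx Sy xy.
case: (bl x == bl y); case: H1 => H1; case: H2 => H2; rewrite -?H1 -?H2; case=> -[] //.
all: by move: H1; rewrite -H2.
Qed.

(** Decreasing or constant from an interval to the next is excluded, since the
value at one point would bound [f] on a set of [U]. *)
Lemma unbounded_trichotomy f : unbounded_mod U f -> exists2 S : set nat, U S &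
  incr_across f S /\ [\/ mono_within ltn f S, mono_within eq_op f S | mono_within gtn f S].
Proof.
move=> fub; have [S US [i [j Sij]]] := homogeneous (fun x y => (f x <= f y, f y <= f x)).
exists S => //; split; last first.
  case: i Sij => -[] [] Sij; [constructor 2|constructor 1|constructor 3|constructor 3];
    move=> x y Sx Sy xy /eqP E; have := Sij x y Sx Sy xy; rewrite E => -[] /=; lia.
have Sj x y : S x -> S y -> bl x < bl y -> (f x <= f y, f y <= f x) = j.
  by move=> Sx Sy lt; rewrite (Sij x y) ?(ltn_eqF lt) ?(block_lt lt).
case: j Sj {Sij} => j1 [] Sj; last by move=> x y Sx Sy /(Sj x y Sx Sy)[_]; lia.
have [x0 Sx0] := uf_nonempty US.
case: (fub _ (uf_setI US (uf_tail U (p (bl x0).+1)))); exists (f x0) => x [Sx /= /le_block lt].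
by have [_] := Sj x0 x Sx0 Sx lt.
Qed.

Lemma unbounded_a_fun S : U S -> unbounded_mod U (a_fun p S).
Proof.
move=> US; apply: contrapT => /const_of_bounded[m Um].
have [x [y [[Sx xm] [Sy ym] xy E]]] := same_block_pair (uf_setI US Um).
by have := a_fun_lt Sx xy E; rewrite xm ym ltnn.
Qed.

Lemma unbounded_b_fun S : U S -> unbounded_mod U (b_fun p S).
Proof.
move=> US; apply: contrapT => /const_of_bounded[m Um].
have [x [y [[Sx xm] [Sy ym] xy E]]] := same_block_pair (uf_setI US Um).
by have := b_fun_lt Sx xy E; rewrite xm ym ltnn.
Qed.

(** * Comparison with the three cuts *)

Definition aboveA := above U (A_family U p).
Definition aboveB := above U (B_family U p).
Definition aboveC := above U (C_family U p).

Lemma aboveAP f : aboveA f <-> exists2 S : set nat, U S & U [set x | a_fun p S x <= f x].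
Proof. by split=> [[_ [S US <-] H]|[S US H]]; [exists S|exists (a_fun p S) => //; exists S]. Qed.

Lemma aboveBP f : aboveB f <-> exists2 S : set nat, U S & U [set x | b_fun p S x <= f x].
Proof. by split=> [[_ [S US <-] H]|[S US H]]; [exists S|exists (b_fun p S) => //; exists S]. Qed.

Lemma aboveCP f : aboveC f <-> exists2 S : set nat, U S & U [set x | c_fun p S x <= f x].
Proof. by split=> [[_ [S US <-] H]|[S US H]]; [exists S|exists (c_fun p S) => //; exists S]. Qed.

Lemma unbounded_aboveB f : aboveB f -> unbounded_mod U f.
Proof. by move/aboveBP=> [S US /unbounded_le]; apply; apply: unbounded_b_fun. Qed.

Lemma aboveC_A f : aboveC f -> aboveA f.
Proof.
move=> /aboveCP[S US H]; apply/aboveAP; exists S => //.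
by apply: filterS H => x /=; rewrite abc_fun; lia.
Qed.

Lemma aboveC_B f : aboveC f -> aboveB f.
Proof.
move=> /aboveCP[S US H]; apply/aboveBP; exists S => //.
by apply: filterS H => x /=; rewrite abc_fun; lia.
Qed.

Lemma aboveA_within f S : U S -> mono_within ltn f S -> aboveA f.
Proof.
move=> US fw; apply/aboveAP; exists S => //; apply: filterS US => x Sx.
exact: a_fun_le.
Qed.

(** Omitting the first interval that meets [S] makes the values of [f]
positive, as [b_fun_le] demands. *)
Lemma aboveB_within f S : U S -> incr_across f S -> mono_within gtn f S -> aboveB f.
Proof.
move=> US fa fw; have [x0 Sx0] := uf_nonempty US.
have UT := uf_setI US (uf_tail U (p (bl x0).+1)).
apply/aboveBP; exists (S `&` [set x | p (bl x0).+1 <= x]) => //.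
apply: filterS UT => x Tx; apply: b_fun_le => //.
  by apply: mono_within_sub fw => y [].
by move=> y [Sy /= /le_block lt]; apply: leq_ltn_trans (fa _ _ Sx0 Sy lt).
Qed.

(** For a first point [q] of an interval, [f x >= f q >= b_fun p T q], and the
last number is [c_fun p T x]. *)
Lemma aboveB_aboveC f : nondecreasing_mod U f -> aboveB f -> aboveC f.
Proof.
move=> [R UR fR] /aboveBP[S US H]; pose T := S `&` (R `&` [set x | b_fun p S x <= f x]).
have UT : U T by apply: uf_setI => //; apply: uf_setI.
apply/aboveCP; exists T => //; apply: filterS UT => x Tx /=.
have [q [Tq qx _ <-]] := c_fun_first Tx.
apply: (@leq_trans (f q)); last first.
  by apply: fR => //; apply/mem_set; [case: Tq => _ []|case: Tx => _ []].
case: Tq => _ [_]; apply: leq_trans; apply: card_itv_sub.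
by move=> y [].
Qed.

(** Above [B], [f] bounds some [b_fun p S], which decreases somewhere on each
set of [U]. Below [B], it bounds no function of decreasing type, and the other
types are nondecreasing. *)
Lemma f_quasi_selectiveP f : unbounded_mod U f -> (f_quasi_selective U f <-> ~ aboveB f).
Proof.
move=> fub; split=> [[_ fQS] /aboveBP[S US H]|nB].
  have [T UT bT] := fQS (b_fun p S) (ex_intro2 _ _ _ H (fun x => id)).
  have [x [y [[Sx Tx] [Sy Ty] xy E]]] := same_block_pair (uf_setI US UT).
  have := b_fun_lt Sx xy E.
  by rewrite ltnNge bT ?mem_set //; apply: ltnW.
split=> // g [S US gf].
have [gub|/const_of_bounded[m Um]] := pselect (unbounded_mod U g); last first.
  by exists [set x | g x = m] => // x y /set_mem /= -> /set_mem /= ->.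
have [T UT [ga gw]] := unbounded_trichotomy gub.
exists T => //; apply: across_homo => //.
case: gw => gw x y Tx Ty xy E; first by apply: ltnW; apply: gw.
  by rewrite (eqP (gw x y Tx Ty xy E)).
by case: nB; apply: above_le (aboveB_within UT ga gw) _; apply: filterS US.
Qed.

Lemma not_all_quasi_selective : exists2 f, unbounded_mod U f & ~ f_quasi_selective U f.
Proof.
have UT : U setT by apply: filterT.
have bub := unbounded_b_fun UT.
exists (b_fun p setT) => // /f_quasi_selectiveP; apply=> //.
by apply/aboveBP; exists setT => //; apply: filterS UT => x /=.
Qed.

Lemma properly_quasi_selectiveP :
  properly_quasi_selective U <-> exists2 f, unbounded_mod U f & ~ aboveB f.
Proof.
split=> [[[f fub /f_quasi_selectiveP nB] _]|[f fub nB]].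
  by exists f => //; apply: nB.
split; first by exists f => //; apply/f_quasi_selectiveP.
by move=> all; have [g gub] := not_all_quasi_selective; apply; apply: all.
Qed.

Lemma a_fun_across S : U S -> exists2 T : set nat, U T & T `<=` S /\ incr_across (a_fun p S) T.
Proof.
move=> US; have [T UT [aT _]] := unbounded_trichotomy (unbounded_a_fun US).
exists (S `&` T); first exact: uf_setI.
by split=> [x []//|]; apply: incr_across_sub aT => x [].
Qed.

Lemma b_fun_across S : U S -> exists2 T : set nat, U T & T `<=` S /\ incr_across (b_fun p S) T.
Proof.
move=> US; have [T UT [bT _]] := unbounded_trichotomy (unbounded_b_fun US).
exists (S `&` T); first exact: uf_setI.
by split=> [x []//|]; apply: incr_across_sub bT => x [].
Qed.

(** * Strong quasi-selectivity *)

(** An [f]-quasi-selective [U] makes [f] itself nondecreasing, hence strictly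
increasing if [f] is injective. Conversely [a_fun p S] is only injective on a
set of [U] and has to be corrected off that set. *)
Lemma strongly_quasi_selectiveP :
  strongly_quasi_selective U <-> exists2 f, aboveA f & ~ aboveB f.
Proof.
split=> [[f finj fQS]|[f /aboveAP[S US Hf] nB]].
  exists f; last by apply/f_quasi_selectiveP => //; case: fQS.
  have [T UT fT] : nondecreasing_mod U f.
    by apply: fQS.2; exists setT; first exact: filterT.
  apply: (aboveA_within UT) => x y Tx Ty xy _.
  rewrite /= ltn_neqAle (fT x y) ?mem_set ?(ltnW xy) // andbT.
  by apply/eqP => /finj E; rewrite E ltnn in xy.
have [T UT [TS aT]] := a_fun_across US.
have aw : mono_within ltn (a_fun p S) T by apply: mono_within_sub TS _; apply: a_fun_within.
have [g ginj Hg] := extend_injective UT (across_inj aT (or_introl aw)).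
exists g => //; apply/f_quasi_selectiveP.
  by apply: (@unbounded_of_inj U g setT) => [|x y _ _ /ginj]; first exact: filterT.
move=> /above_le gB; apply: nB; apply: gB.
by apply: filterS2 Hf Hg => x /= + <-.
Qed.

Lemma quasi_selectiveP : quasi_selective U <-> ~ aboveC id.
Proof.
rewrite /quasi_selective (f_quasi_selectiveP (@unbounded_id U)).
split=> nB; first by move/aboveC_B.
by move/aboveB_aboveC => H; apply: nB; apply: H; exists setT; first exact: filterT.
Qed.

(** The witness must be replaced by some [a_fun p S] below it, which is
nondecreasing on a set of [U], so that [aboveB_aboveC] applies. *)
Lemma strongly_quasi_selectiveCP :
  strongly_quasi_selective U <-> exists2 f, aboveA f & ~ aboveC f.
Proof.
rewrite strongly_quasi_selectiveP; split=> [[f fA nB]|[f /aboveAP[S US Hf] nC]].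
  by exists f => // /aboveC_B.
exists (a_fun p S); first by apply/aboveAP; exists S => //; apply: filterS US => x /=.
have [T UT [TS aT]] := a_fun_across US.
move=> /aboveB_aboveC aC; apply: nC; apply: above_le (aC _) Hf.
exists T => //; apply: across_homo => // x y Tx Ty xy E.
by apply: ltnW; apply: a_fun_lt => //; apply: TS.
Qed.

(** * Isomorphic quasi-selective ultrafilters *)

Lemma injective_aboveA_or_B f S : U S -> {in S &, injective f} -> aboveA f \/ aboveB f.
Proof.
move=> US finj; have [T UT [fa []fw]] := unbounded_trichotomy (unbounded_of_inj US finj).
- by left; apply: aboveA_within UT fw.
- have [x [y [[Sx Tx] [Sy Ty] xy E]]] := same_block_pair (uf_setI US UT).
  have /eqP/(finj _ _ (mem_set Sx) (mem_set Sy)) E' := fw x y Tx Ty xy E.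
  by rewrite E' ltnn in xy.
- by right; apply: aboveB_within UT fa fw.
Qed.

(** In either case the only type that a function bounded by [f] cannot have is
the one that would be opposite to the type of [f] inside intervals. *)
Lemma quasi_selective_image_mono f S : U S -> incr_across f S ->
  mono_within ltn f S /\ ~ aboveB f \/ mono_within gtn f S /\ ~ aboveA f ->
  exists V : npultrafilter, quasi_selective V /\ isomorphic U V.
Proof.
move=> US fa fw.
have finj : {in S &, injective f}.
  by apply: across_inj fa _ => //; case: fw => -[fw _]; [left|right].
have [V VU] := image_ultrafilter (unbounded_of_inj US finj).
exists V; split; last by exists f; split=> //; exists S.
apply/(quasi_selective_imageP VU US finj) => h hf.
have [hub|/const_of_bounded[m Um]] := pselect (unbounded_mod U h); last first.
  by exists [set x | h x = m] => // x y /= -> ->.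
have [T UT [ha hw]] := unbounded_trichotomy hub.
exists (S `&` T); first exact: uf_setI.
have across_case x y : S x -> S y -> T x -> T y -> bl x != bl y -> f x <= f y -> h x <= h y.
  move=> Sx Sy Tx Ty; rewrite neq_ltn => /orP[/ha lt _|lt]; first exact/ltnW/lt.
  by have := fa y x Sy Sx lt; lia.
move=> x y [Sx Tx] [Sy Ty] fxy.
have [E|/across_case] := eqVneq (bl x) (bl y); last by apply.
case: (ltngtP x y) => [xy|xy|->//].
- case: fw => -[fw nf]; last by have := fw x y Sx Sy xy E; rewrite /=; lia.
  case: hw => hw; have /= := hw x y Tx Ty xy E; [lia|by move/eqP->|].
  by case: nf; apply: above_le hf; apply: aboveB_within UT ha hw.
- case: fw => -[fw nf]; first by have := fw y x Sy Sx xy (esym E); rewrite /=; lia.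
  case: hw => hw; have /= := hw y x Ty Tx xy (esym E); [|by move/eqP->|lia].
  by case: nf; apply: above_le hf; apply: aboveA_within UT hw.
Qed.

Lemma isomorphic_quasi_selectiveP :
  (exists V : npultrafilter, quasi_selective V /\ isomorphic U V) <->
  exists f, aboveA f /\ ~ aboveB f \/ aboveB f /\ ~ aboveA f.
Proof.
split=> [[V [QS [phi [[S US phinj] VU]]]]|[f [[/aboveAP[S US Hf] nB]|[/aboveBP[S US Hf] nA]]]].
- exists phi; apply: contrapT => no.
  have [aA aB] : aboveA phi /\ aboveB phi.
    have [|] := injective_aboveA_or_B US phinj => H; split=> //.
      by apply: contrapT => H'; apply: no; left.
    by apply: contrapT => H'; apply: no; right.
  have {}QS := (quasi_selective_imageP VU US phinj).1 QS.
  move/aboveAP: aA => [S1 US1 /QS[T1 UT1 H1]]; move/aboveBP: aB => [S2 US2 /QS[T2 UT2 H2]].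
  have [x [y [[[S1x T1x] [S2x T2x]] [[S1y T1y] [S2y T2y]] xy E]]] :=
    same_block_pair (uf_setI (uf_setI US1 UT1) (uf_setI US2 UT2)).
  have := a_fun_lt S1x xy E; have := b_fun_lt S2x xy E.
  by case/orP: (leq_total (phi x) (phi y)) => [/(H2 x y T2x T2y)|/(H1 y x T1y T1x)]; lia.
- have [T UT [TS aT]] := a_fun_across US.
  apply: (quasi_selective_image_mono UT aT); left; split.
    by apply: mono_within_sub TS _; apply: a_fun_within.
  by move=> /above_le H; apply: nB; apply: H.
- have [T UT [TS aT]] := b_fun_across US.
  apply: (quasi_selective_image_mono UT aT); right; split.
    by apply: mono_within_sub TS _; apply: b_fun_within.
  by move=> /above_le H; apply: nA; apply: H.
Qed.

(** * Rapidity *)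

(** Pairs from two intervals have the same truth value of [h x < y], and for
fixed [x] this holds for large [y]. *)
Lemma uf_sparse h : exists2 S : set nat, U S &
  forall x y, S x -> S y -> bl x < bl y -> h x < y.
Proof.
have [S US [i [j Sij]]] := homogeneous (fun x y => h x < y).
exists S => // x y Sx Sy lt.
have Sj x' y' : S x' -> S y' -> bl x' < bl y' -> (h x' < y') = j.
  by move=> Sx' Sy' lt'; rewrite Sij // ?(ltn_eqF lt') // (block_lt lt').
rewrite (Sj x y) //.
have [z Sz zx] := uf_infinite US (maxn (p (bl x).+1) (h x).+1).
by rewrite -(Sj x z) //; [lia|apply: le_block => //; lia].
Qed.

Lemma increasing_majorant f : exists2 g, {homo g : m n / m < n} & forall n, f n <= g n.
Proof.
exists (fun n => \sum_(0 <= i < n.+1) (f i).+1).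
  move=> m n; elim: n => // n IH; rewrite ltnS [X in _ < X]big_nat_recr //= leq_eqVlt.
  by case/predU1P=> [->|/IH]; lia.
by move=> n; rewrite big_nat_recr //=; lia.
Qed.

(** If [k <= f] holds past [N k], a set of [U] whose [k]-th point exceeds [N k]
for all [k] has at most [f x] points before the end of the interval of [x]. *)
Lemma aboveB_of_rapid : rapid U -> forall f, unbounded_mod U f -> aboveB f.
Proof.
move=> rU f fub; have [S US [fa _]] := unbounded_trichotomy fub.
have large k : exists N, forall x, S x -> N < p (bl x).+1 -> k <= f x.
  have [y [Sy fy]] : exists y, S y /\ k < f y.
    apply: contrapT => no; apply: (fub _ US); exists k => x Sx.
    by rewrite leqNgt; apply/negP => lt; apply: no; exists x.
  exists (p (bl y).+1) => x Sx lt; apply: ltnW; apply: (ltn_trans fy); apply: fa => //.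
  rewrite ltnNge; apply/negP => le.
  by have := interval_partition_mono (le : (bl x).+1 <= (bl y).+1); lia.
have [N NP] := choice large; have [g ginc Ng] := increasing_majorant N.
have [u [uinc UT ug]] := rU g ginc.
apply/aboveBP; exists (u @` [set n | 0 < n]) => //.
apply: filterS US => x Sx /=.
have le_u : p (bl x).+1 <= u (f x).+1.
  rewrite leqNgt; apply/negP => lt; have := NP (f x).+1 x Sx.
  by rewrite ltnn; apply/implyP; have := Ng (f x).+1; have := ug (f x).+1 isT; lia.
rewrite /b_fun /card_itv -size_filter.
rewrite -[f x](size_iota 1) -[size (iota _ _)](size_map u); apply: uniq_leq_size.
  by rewrite filter_uniq ?iota_uniq.
move=> y; rewrite mem_filter mem_index_iota => /andP[/set_mem[n /= n0 <-] /andP[_ un]].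
apply/mapP; exists n => //; rewrite mem_iota n0 add1n ltnNge; apply/negP => le.
move: le; rewrite leq_eqVlt => /predU1P[E|]; first by rewrite E in le_u; lia.
by move=> /(uinc (f x).+1 n isT n0); lia.
Qed.

(** For [x] in [T], the number of points of [T] up to [x] is at most [a + f x],
where [a] counts the points in earlier intervals. If [a <= f x], the slow growth
of [f] puts [g] of this number below the interval of [x]; otherwise [a] is at
most one more than some earlier point [y], and [x] is far beyond [y] by
[uf_sparse]. *)
Lemma rapid_of_aboveB : (forall f, unbounded_mod U f -> aboveB f) -> rapid U.
Proof.
move=> allB g ginc.
have gle m n : m <= n -> g m <= g n by rewrite leq_eqVlt => /predU1P[->//|/ginc/ltnW].
(* The largest [i <= z] such that [g] at [2 i] is below [z], or [0] if none. *)
pose k z := \max_(i < z.+1 | g i.*2 < z) i.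
have kP z : 0 < k z -> g (k z).*2 < z.
  rewrite /k; case: (boolP [exists i : 'I_z.+1, g i.*2 < z]) => [/existsP[i gi]|no].
    by rewrite (bigop.bigmax_eq_arg i) //; case: arg_maxnP.
  rewrite big_pred0 // => i; apply/negbTE; apply: contra no => gi.
  by apply/existsP; exists i.
have k_ge m z : m <= z -> g m.*2 < z -> m <= k z.
  rewrite -ltnS => mz gm.
  exact: (@leq_bigmax_cond _ (fun i : 'I_z.+1 => g i.*2 < z) (fun i => val i) (Ordinal mz) gm).
pose f x := k (p (bl x)).
have fub : unbounded_mod U f.
  move=> S US [m fm].
  have [x Sx] := uf_infinite US (p (maxn m.+1 (g m.+1.*2).+1)).
  move=> /le_block le; have := fm x Sx.
  suff : m.+1 <= f x by lia.
  by apply: k_ge; have := le_interval_partition (bl x); lia.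
have /aboveBP[S US Hf] := allB f fub.
have [R UR sR] := uf_sparse (fun x => g x.+1.*2).
pose T := S `&` R `&` [set x | b_fun p S x <= f x].
have UT : U T by apply: uf_setI => //; apply: uf_setI.
have TP x : T x -> g (card_itv T 0 x).+1 < x.
  move=> Tx; have /andP[bx xb] := blockP x hp.
  have cT : card_itv T (p (bl x)) x.+1 <= f x.
    have [q [Tq _ qE cq]] := c_fun_first Tx.
    apply: (@leq_trans (c_fun p T x)).
      by rewrite /c_fun (@card_itv_cat T _ x.+1 (p _.+1)) ?leq_addr //; lia.
    rewrite -cq; have -> : f x = f q by rewrite /f qE.
    case: Tq => _; apply: leq_trans.
    by apply: card_itv_sub => y [[]].
  have cTS : card_itv T (p (bl x)) x < card_itv T (p (bl x)) x.+1.
    rewrite (@card_itv_cat T (p _) x x.+1) //.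
    by rewrite -[X in X < _]addn0 ltn_add2l (@card_itv_gt0 T x x.+1 x).
  rewrite (@card_itv_cat T 0 (p (bl x)) x) //.
  set a := card_itv T 0 _; set b := card_itv T _ x.
  have [ab|ba] := leqP a (f x).
    apply: (@leq_ltn_trans (g (f x).*2)); first by apply: gle; rewrite /a /b in ab *; lia.
    by apply: (@leq_trans (p (bl x))) => //; apply: kP; rewrite -/(f x); lia.
  have [y [Ty yx ay]] : exists y, [/\ T y, y < p (bl x) & a <= y.+1].
    apply: contrapT => no; suff : a <= a.-1 by rewrite /a in ba *; lia.
    apply: (@card_itv_le_inj T id 0 (p (bl x)) 0) => [y Ty /= yx|].
      by rewrite add0n ltnNge; apply/negP => ay; apply: no; exists y; split=> //; lia.
    by move=> ? ? _ _ _ /=; lia.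
  apply: (@leq_ltn_trans (g y.+1.*2)); first by apply: gle; rewrite /a /b in ba ay *; lia.
  apply: sR; [by case: Ty => -[]|by case: Tx => -[]|].
  rewrite ltnNge; apply/negP => le; have := interval_partition_mono le.
  by have /andP[] := blockP y hp; lia.
have [u [uinc uT uc]] := enum_infinite (uf_infinite UT).
exists (u \o predn); split=> [[|m] [|n] // _ _ mn||[//|n] _].
- exact: uinc.
- apply: filterS UT => x; rewrite -uT => -[n _ <-]; by exists n.+1.
- by have := TP (u n); rewrite uc /=; apply; rewrite -uT; exists n.
Qed.

End Partition.

Theorem corollary2p4 (U : npultrafilter) (p : nat -> nat)
  (hU : properly_weakly_Ramsey U)
  (hp : interval_partition p)
  (hsel : ~ has_selection_set U p) :
  ((properly_quasi_selective U <-> cutN U <> cutB U p) /\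
   (properly_quasi_selective U <-> ~ rapid U)) /\
  ((strongly_quasi_selective U <-> cut_lt (cutA U p) (cutB U p)) /\
   (strongly_quasi_selective U <-> cutA U p <> cutC U p) /\
   (quasi_selective U <-> fun_lt_cut id (cutC U p))) /\
  ((exists V : npultrafilter, quasi_selective V /\ isomorphic U V) <->
   cutA U p <> cutB U p).
Proof.
have [hWR _] := hU.
have leftN := @cut_left_N U.
have leftA f : cut_left (cutA U p) (ucls U f) <-> ~ aboveA p U f by apply: cut_left_above.
have leftB f : cut_left (cutB U p) (ucls U f) <-> ~ aboveB p U f by apply: cut_left_above.
have leftC f : cut_left (cutC U p) (ucls U f) <-> ~ aboveC p U f by apply: cut_left_above.
have nleft (P Q : Prop) : (P <-> ~ Q) -> (~ P <-> Q).
  by move=> PQ; split=> [nP|q /PQ//]; apply: contrapT => /PQ.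
split; [split|split; [split; [|split]|]].
- apply: (iff_trans (properly_quasi_selectiveP hp hWR hsel)).
  apply: iff_trans (iff_sym (cut_neqP _)) => [|f].
    by split=> -[f Hf nB]; exists f; (try by apply/leftB); apply/(nleft _ _ (leftN f)).
  by move=> /leftN nub; apply/leftB => fB; apply: nub; apply: (unbounded_aboveB hp hsel).
- apply: (iff_trans (properly_quasi_selectiveP hp hWR hsel)); split=> [[f fub nB] rU|nr].
    by apply: nB; apply: aboveB_of_rapid.
  apply: contrapT => no; apply: nr; apply: (rapid_of_aboveB hp) => // f fub.
  by apply: contrapT => nB; apply: no; exists f.
- apply: (iff_trans (strongly_quasi_selectiveP hp hWR hsel)).
  apply: iff_trans (iff_sym (cut_ltP _ _)).
  by split=> -[f Hf nB]; exists f; (try by apply/leftB); apply/(nleft _ _ (leftA f)).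
- apply: (iff_trans (strongly_quasi_selectiveCP hp hWR hsel)).
  apply: iff_trans (iff_sym (cut_neqP _)) => [|f].
    by split=> -[f Hf nB]; exists f; (try by apply/leftC); apply/(nleft _ _ (leftA f)).
  by move=> /leftA nA; apply/leftC => /(aboveC_A hp).
- apply: (iff_trans (quasi_selectiveP hp hWR hsel)).
  exact: iff_sym (leftC id).
- apply: (iff_trans (isomorphic_quasi_selectiveP hp hWR hsel)); split.
    move=> [f [[fA nB]|[fB nA]]] E.
      by move/leftB: nB; rewrite -E => /leftA.
    by move/leftA: nA; rewrite E => /leftB.
  move=> neq; apply: contrapT => no; apply: neq; apply: cut_eq.
  apply/seteqP; split; apply: cut_subP => f.
    move=> /leftA nA; apply/leftB => fB; apply: no; exists f; by right.
  move=> /leftB nB; apply/leftA => fA; apply: no; exists f; by left.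
Qed.
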